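(* The Dowker complex, $(X,Y,R)\mapsto D(X,Y,R)$, is a covariant functor $D:\mathbf{Rel}\to\mathbf{Asc}$.
   Context: The category $\mathbf{Rel}$ has as objects triples $(X,Y,R)$ in which $X,Y$ are sets and $R\subseteq X\times Y$ is a relation. A morphism $(X,Y,R)\to(X',Y',R')$ is a pair of functions $f:X\to X'$, $g:Y\to Y'$ such that $(f(x),g(y))\in R'$ whenever $(x,y)\in R$. Composition of morphisms is composition of the corresponding pairs of functions. An abstract simplicial complex $K$ on a set $V_K$ (whose elements are the vertices) is a set $K$ of subsets of $V_K$ (called simplices) such that if $\sigma\in K$ and $\tau\subseteq\sigma$, then $\tau\in K$. A simplicial map $K\to L$ is a function $f:V_K\to V_L$ on vertices that transforms each simplex $[v_0,\dots,v_k]$ of $K$ into a simplex $[f(v_0),\dots,f(v_k)]$ of $L$, after removing duplicate vertices. The category $\mathbf{Asc}$ has abstract simplicial complexes as objects and simplicial maps as morphisms. The Dowker complex of a relation $R\subseteq X\times Y$ is the abstract simplicial complex $D(X,Y,R)=\{[x_{i_0},\dots,x_{i_k}] : \text{there exists a } y\in Y \text{ such that } (x_{i_j},y)\in R \text{ for all } j=0,\dots,k\}$, with vertices taken from $X$. *)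

(* Defs.v *)
From mathcomp Require Import all_boot.
From mathcomp Require Import boolp classical_sets functions cardinality.

Set Implicit Arguments.
Unset Strict Implicit.
Unset Printing Implicit Defensive.

Local Open Scope classical_set_scope.

Record category := Category {
  obj :> Type;
  hom : obj -> obj -> Type;
  idm : forall a, hom a a;
  comp : forall a b c, hom b c -> hom a b -> hom a c;
  comp_idl : forall a b (m : hom a b), comp (idm b) m = m;
  comp_idr : forall a b (m : hom a b), comp m (idm a) = m;
  comp_assoc : forall a b c d (p : hom c d) (n : hom b c) (m : hom a b),
    comp p (comp n m) = comp (comp p n) m
}.

Record is_functor (C D : category) (F0 : C -> D)
    (F1 : forall a b : C, hom a b -> hom (F0 a) (F0 b)) : Prop := IsFunctor {
  functor_id : forall a : C, F1 a a (idm a) = idm (F0 a);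
  functor_comp : forall (a b c : C) (n : hom b c) (m : hom a b),
    F1 a c (comp n m) = comp (F1 b c n) (F1 a b m)
}.

Record relation_obj := RelationObj {
  rel_dom : Type;
  rel_cod : Type;
  rel_graph : set (rel_dom * rel_cod)
}.

Record rel_hom (A B : relation_obj) := RelHom {
  hom_dom : rel_dom A -> rel_dom B;
  hom_cod : rel_cod A -> rel_cod B;
  hom_graph : forall x y,
    rel_graph (r:=A) (x, y) -> rel_graph (r:=B) (hom_dom x, hom_cod y)
}.

Lemma rel_hom_eq (A B : relation_obj) (m n : rel_hom A B) :
  hom_dom m = hom_dom n -> hom_cod m = hom_cod n -> m = n.
Proof.
case: m n => f g h [f' g' h'] /= ef eg; subst f' g'.
by congr RelHom; exact: Prop_irrelevance.
Qed.

Definition rel_id (A : relation_obj) : rel_hom A A :=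
  @RelHom A A id id (fun _ _ h => h).

Definition rel_comp (A B C : relation_obj) (n : rel_hom B C) (m : rel_hom A B) :
    rel_hom A C :=
  @RelHom A C (hom_dom n \o hom_dom m) (hom_cod n \o hom_cod m)
    (fun _ _ h => hom_graph n (hom_graph m h)).

Definition Rel : category.
Proof.
by refine (@Category relation_obj rel_hom rel_id rel_comp _ _ _);
  move=> *; apply: rel_hom_eq.
Defined.

(* The empty simplex is permitted: downward closure forces it into every
   complex having at least one simplex. *)
Record asc_obj := AscObj {
  vertex : Type;
  simplex : set (set vertex);
  simplex_sub : forall sigma tau : set vertex,
    simplex sigma -> tau `<=` sigma -> simplex tau
}.

(* Simplices being sets, taking the direct image removes duplicate vertices. *)
Record simplicial_map (K L : asc_obj) := SimplicialMap {
  vertex_map : vertex K -> vertex L;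
  vertex_map_simplex : forall sigma,
    simplex (a:=K) sigma -> simplex (a:=L) (vertex_map @` sigma)
}.

Lemma simplicial_map_eq (K L : asc_obj) (m n : simplicial_map K L) :
  vertex_map m = vertex_map n -> m = n.
Proof.
case: m n => f h [f' h'] /= ef; subst f'.
by congr SimplicialMap; exact: Prop_irrelevance.
Qed.

Definition asc_id (K : asc_obj) : simplicial_map K K.
Proof.
by refine (@SimplicialMap K K id _) => sigma; rewrite image_id.
Defined.

Definition asc_comp (K L M : asc_obj) (n : simplicial_map L M)
    (m : simplicial_map K L) : simplicial_map K M.
Proof.
refine (@SimplicialMap K M (vertex_map n \o vertex_map m) _) => sigma hs.
by rewrite -image_comp; do 2 apply: vertex_map_simplex.
Defined.

Definition Asc : category.
Proof.
by refine (@Category asc_obj simplicial_map asc_id asc_comp _ _ _);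
  move=> *; apply: simplicial_map_eq.
Defined.

(* The vertex set is all of X, even for points related to nothing.  The empty
   simplex belongs to the complex exactly when Y is inhabited. *)
Definition dowker_simplex (X Y : Type) (R : set (X * Y)) : set (set X) :=
  [set sigma | finite_set sigma /\ exists y, forall x, sigma x -> R (x, y)].

Lemma dowker_simplex_sub (X Y : Type) (R : set (X * Y)) (sigma tau : set X) :
  dowker_simplex R sigma -> tau `<=` sigma -> dowker_simplex R tau.
Proof.
move=> [fin_s [y sRy]] tau_s; split; first exact: sub_finite_set fin_s.
by exists y => x /tau_s /sRy.
Qed.

Definition dowker (A : Rel) : Asc :=
  @AscObj (rel_dom A) (dowker_simplex (@rel_graph A))
    (@dowker_simplex_sub _ _ (@rel_graph A)).

(* Main.v *)
Require Import Defs.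
From mathcomp Require Import all_boot.
From mathcomp Require Import boolp classical_sets functions cardinality.

(** A morphism acts on vertices by [hom_dom], while [hom_cod] carries witnesses to witnesses.
    Simplicial maps are determined by their vertex maps, so functoriality reduces to that of
    [hom_dom]. *)

(* If y witnesses that sigma is a simplex, then its image under the codomain
   component of the morphism witnesses that the image of sigma is one. *)
Lemma dowker_simplex_image (A B : relation_obj) (m : rel_hom A B)
    (sigma : set (rel_dom A)) :
  dowker_simplex (rel_graph (r:=A)) sigma ->
  dowker_simplex (rel_graph (r:=B)) (image sigma (hom_dom m)).
Proof.
move=> [fin_s [y sRy]]; split; first exact: finite_image.
by exists (hom_cod m y) => _ [x sx <-]; apply/hom_graph/sRy.
Qed.

Definition dowker_map (A B : Rel) (m : hom A B) : hom (dowker A) (dowker B) :=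
  @SimplicialMap (dowker A) (dowker B) (hom_dom m) (@dowker_simplex_image A B m).

(** The first conjunct determines [D1], by [simplicial_map_eq]. *)
Theorem theorem3 :
  exists D1 : forall A B : Rel, hom A B -> hom (dowker A) (dowker B),
    (forall (A B : Rel) (m : hom A B), vertex_map (D1 A B m) = hom_dom m) /\
    @is_functor Rel Asc dowker D1.
Proof.
exists dowker_map; split=> //.
(* In both laws the two vertex maps agree by computation. *)
by split=> *; apply: simplicial_map_eq.
Qed.
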